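(* Let $\Bbbk$ be a field with $\mathrm{char}(\Bbbk)\neq 2$, $n\ge 1$, let $A=Cl(\alpha,\beta_i,\gamma_i,\lambda_{ij})$ be a $2^{n+1}$-dimensional Clifford algebra with its canonical $E(n)$-comodule algebra structure, and let $\mathfrak{T}:E(n)\to A\otimes E(n)^{\mathrm{op}}$ be a total integral on $(E(n),\psi)$. Then $\mathfrak{T}$ satisfies the h-property if and only if $$(\mathrm{Id}_A\otimes\varepsilon)(\mathfrak{T}(g)\mathfrak{T}(g))=1_A,$$ $$(\mathrm{Id}_A\otimes\varepsilon)(\mathfrak{T}(x_P)\mathfrak{T}(g))=(\mathrm{Id}_A\otimes\varepsilon)\mathfrak{T}(gx_P)$$ for every $P\subseteq\{1,\dots,n\}$.
   Context: Everything is over a field $\Bbbk$ with $\mathrm{char}(\Bbbk)\ne2$; $\otimes=\otimes_\Bbbk$; Sweedler notation with suppressed summation is used. $E(n)$ is the $2^{n+1}$-dimensional Hopf algebra generated by $g,x_1,\dots,x_n$ with $g^2=1$, $x_i^2=0$, $gx_i=-x_ig$, $x_ix_j=-x_jx_i$ ($i<j$), $\Delta(g)=g\otimes g$, $\varepsilon(g)=1$, $S(g)=g$, $\Delta(x_i)=x_i\otimes g+1\otimes x_i$, $\varepsilon(x_i)=0$, $S(x_i)=gx_i$. It has a bijective antipode. For $P=\{i_1<\dots<i_s\}\subseteq\{1,\dots,n\}$ put $x_P=x_{i_1}\cdots x_{i_s}$, $x_\emptyset=1$. $Cl(\alpha,\beta_i,\gamma_i,\lambda_{ij})$, for fixed scalars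 $\alpha,\beta_i,\gamma_i$ ($1\le i\le n$), $\lambda_{ij}$ ($i<j$) in $\Bbbk$, is the unital associative algebra generated by $G,X_1,\dots,X_n$ with $G^2=\alpha$, $X_i^2=\beta_i$, $GX_i+X_iG=\gamma_i$, $X_iX_j+X_jX_i=\lambda_{ij}$ ($i<j$); it has dimension $2^{n+1}$. Its canonical $E(n)$-comodule algebra structure is the algebra map $\rho$ with $\rho(G)=G\otimes g$, $\rho(X_i)=X_i\otimes g+1_A\otimes x_i$. For a Hopf algebra $H$ with bijective antipode and right $H$-comodule algebra $(A,\rho)$, $\rho(a)=a_0\otimes a_1$, the cowreath $(A\otimes H^{\mathrm{op}},H,\psi)$ has $\psi(h\otimes a\otimes l)=a_0\otimes l_1\otimes l_2ha_1$. Convention: products written without symbol in $A\otimes H$ in the next two formulas use the ordinary multiplications of $A$ and $H$. An integral on $(H,\psi)$ is a $\Bbbk$-linear map $\mathfrak{T}:H\to A\otimes H^{\mathrm{op}}$, $\mathfrak{T}(h)=\mathfrak{T}^A(h)\otimes\mathfrak{T}^H(h)$, such that for all $a\in A,h\in H$: $$\mathfrak{T}^A(h_2)_0\otimes \mathfrak{T}^H(h_2)_1\otimes \mathfrak{T}^H(h_2)_2h_1\mathfrak{T}^A(h_2)_1=\mathfrak{T}(h)\otimes 1_H,$$ $$(a_0\otimes 1_H)\mathfrak{T}(S^{-1}(a_2)ha_1)(1_A\otimes S^{-1}(a_3))=(1_A\otimes S^{-1}(a_1))\mathfrak{T}(h)(a_0\otimes 1_H).$$ It is total if $\mathfrak{T}(1_H)=1_A\otimes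 1_H$. A total integral satisfies the h-property if $(\mathrm{Id}_A\otimes\varepsilon)(\mathfrak{T}(h)\mathfrak{T}(h'))=(\mathrm{Id}_A\otimes\varepsilon)(\mathfrak{T}(h'h))$ for all $h,h'\in H$ (whether $\mathfrak{T}(h)\mathfrak{T}(h')$ is computed in $A\otimes H$ or $A\otimes H^{\mathrm{op}}$ is irrelevant after applying $\mathrm{Id}_A\otimes\varepsilon$). *)

(* Defs.v *)
From HB Require Import structures.
From mathcomp Require Import all_boot all_order all_algebra all_field.

Set Implicit Arguments.
Unset Strict Implicit.
Unset Printing Implicit Defensive.

Import GRing.Theory.
Import VectorInternalTheory.
Local Open Scope ring_scope.

(* MathComp has no tensor product of vector spaces or algebras.  For finite
   dimensional V and W we represent V ⊗ W by matrices of coordinates with respect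
   to the bases carried by the vectType structures; v ⊗ w is the rank one matrix
   of products of coordinates.  The universal property is [tlift_pure],
   [tlift_linear] and [tens_ext]; the algebra A ⊗ B has the usual componentwise
   product [tensM]. *)
Section Tensor.
Variable k : fieldType.

Definition tensor (V W : vectType k) : Type := 'M[k]_(dim V, dim W).

HB.instance Definition _ (V W : vectType k) :=
  Vector.copy (tensor V W) 'M[k]_(dim V, dim W).

Definition tens (V W : vectType k) (v : V) (w : W) : tensor V W :=
  (v2r v)^T *m v2r w.

Definition tbase (V : vectType k) (i : 'I_(dim V)) : V := r2v (delta_mx 0 i).

(* For f bilinear, this is the linear extension of v ⊗ w |-> f v w; with the
   notation below, \sw_(a, b <- t) E is Sweedler's way of writing E, summed over
   t = a ⊗ b.  It is used in definitions only with E bilinear in (a, b). *)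
Definition tlift (V W : vectType k) (U : lmodType k) (f : V -> W -> U)
    (t : tensor V W) : U :=
  \sum_i \sum_j (t : 'M_(_, _)) i j *: f (tbase i) (tbase j).

End Tensor.

Notation "v ⊗ w" := (tens v w) (at level 40, left associativity) : ring_scope.
Notation "\sw_ ( a , b <- t ) E" := (tlift (fun a b => E) t)
  (at level 41, a name, b name, t at level 60, E at level 41,
   format "\sw_ ( a ,  b  <-  t )  E") : ring_scope.

Section TensorTheory.
Variable k : fieldType.

Definition bilin (V W U : lmodType k) (f : V -> W -> U) :=
  (forall w, linear (f^~ w)) /\ (forall v, linear (f v)).

Lemma tensDl (V W : vectType k) (w : W) : linear (fun v : V => v ⊗ w).
Proof. by move=> a u v; rewrite /tens !linearP /= mulmxDl -scalemxAl. Qed.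

Lemma tensDr (V W : vectType k) (v : V) : linear (fun w : W => v ⊗ w).
Proof. by move=> a u w; rewrite /tens linearP /= mulmxDr -scalemxAr. Qed.

Lemma tens_bilin (V W : vectType k) : bilin (@tens k V W).
Proof. by split; [exact: tensDl | exact: tensDr]. Qed.

Lemma lin0 (V U : lmodType k) (f : V -> U) : linear f -> f 0 = 0.
Proof. by move=> lf; have := lf (-1) 0 0; rewrite scaler0 addr0 scaleN1r addNr. Qed.

Lemma linZ (V U : lmodType k) (f : V -> U) : linear f -> scalable f.
Proof. by move=> lf a u; have := lf a u 0; rewrite (lin0 lf) !addr0. Qed.

Lemma linD (V U : lmodType k) (f : V -> U) : linear f -> {morph f : u v / u + v}.
Proof. by move=> lf u v; have := lf 1 u v; rewrite !scale1r. Qed.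

Lemma lin_sum (V U : lmodType k) (f : V -> U) : linear f ->
  forall (I : finType) (c : I -> k) (x : I -> V),
  f (\sum_i c i *: x i) = \sum_i c i *: f (x i).
Proof.
move=> lf I c x.
rewrite (big_morph f (linD lf) (lin0 lf)).
by apply: eq_bigr => i _; rewrite linZ.
Qed.

Lemma tbase_sum (V : vectType k) (v : V) : v = \sum_i (v2r v 0 i) *: tbase i.
Proof.
rewrite -[LHS]v2rK [in LHS](row_sum_delta (v2r v)) linear_sum.
by apply: eq_bigr => i _; rewrite linearZ.
Qed.

Lemma tlift_pure (V W : vectType k) (U : lmodType k) (f : V -> W -> U) v w :
  bilin f -> tlift f (v ⊗ w) = f v w.
Proof.
move=> [fl fr]; rewrite [in RHS](tbase_sum v) [in RHS](tbase_sum w).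
rewrite (lin_sum (fl _)); apply: eq_bigr => i _.
rewrite (lin_sum (fr _)) scaler_sumr; apply: eq_bigr => j _.
by rewrite scalerA /tens mxE big_ord1 mxE.
Qed.

Lemma tlift_linear (V W : vectType k) (U : lmodType k) (f : V -> W -> U) :
  linear (tlift f).
Proof.
move=> a t u; rewrite /tlift scaler_sumr -big_split; apply: eq_bigr => i _.
rewrite /= scaler_sumr -big_split; apply: eq_bigr => j _.
by rewrite /= !mxE scalerDl scalerA.
Qed.

HB.instance Definition _ (V W : vectType k) (U : lmodType k) f :=
  GRing.isSemilinear.Build k (tensor V W) U _ (@tlift k V W U f)
    (GRing.semilinear_linear (tlift_linear f)).

Lemma tens_addl (V W : vectType k) (u v : V) (w : W) :
  (u + v) ⊗ w = u ⊗ w + v ⊗ w.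
Proof. exact: (linD (tensDl w)). Qed.

Lemma tens_addr (V W : vectType k) (v : V) (u w : W) :
  v ⊗ (u + w) = v ⊗ u + v ⊗ w.
Proof. exact: (linD (tensDr v)). Qed.

Lemma tens_scalel (V W : vectType k) a (v : V) (w : W) :
  (a *: v) ⊗ w = a *: (v ⊗ w).
Proof. exact: (linZ (tensDl w)). Qed.

Lemma tens_scaler (V W : vectType k) a (v : V) (w : W) :
  v ⊗ (a *: w) = a *: (v ⊗ w).
Proof. exact: (linZ (tensDr v)). Qed.

Lemma tens_0l (V W : vectType k) (w : W) : (0 : V) ⊗ w = 0.
Proof. exact: (lin0 (tensDl w)). Qed.

Lemma tens_0r (V W : vectType k) (v : V) : v ⊗ (0 : W) = 0.
Proof. exact: (lin0 (tensDr v)). Qed.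

Lemma tens_tbase (V W : vectType k) i j :
  (tbase i : V) ⊗ (tbase j : W) = delta_mx i j.
Proof. by rewrite /tens /tbase !r2vK trmx_delta mul_delta_mx. Qed.

Lemma tens_sum (V W : vectType k) (t : tensor V W) :
  t = \sum_i \sum_j (t : 'M_(_, _)) i j *: (tbase i ⊗ tbase j).
Proof.
rewrite [LHS](matrix_sum_delta t).
by apply: eq_bigr => i _; apply: eq_bigr => j _; rewrite tens_tbase.
Qed.

Lemma tens_ind (V W : vectType k) (P : tensor V W -> Prop) :
  (forall a t u, P t -> P u -> P (a *: t + u)) ->
  (forall v w, P (v ⊗ w)) -> forall t, P t.
Proof.
move=> Plin Pp t.
have P0 : P 0 by have := Plin (-1) _ _ (Pp 0 0) (Pp 0 0); rewrite scaleN1r addNr.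
have PZ a u : P u -> P (a *: u) by move=> Pu; rewrite -[X in P X]addr0; apply: Plin.
have PD u v : P u -> P v -> P (u + v).
  by move=> Pu Pv; rewrite -[u]scale1r; apply: Plin.
by rewrite (tens_sum t); do 2![apply: big_ind => // ? _]; apply: PZ.
Qed.

Lemma tens_ext (V W : vectType k) (U : lmodType k) (f g : tensor V W -> U) :
  linear f -> linear g -> (forall v w, f (v ⊗ w) = g (v ⊗ w)) -> f =1 g.
Proof.
move=> lf lg fg; apply: tens_ind => [a t u eq1 eq2|//].
by rewrite lf lg eq1 eq2.
Qed.


Lemma eq_tlift (V W : vectType k) (U : lmodType k) (f g : V -> W -> U) :
  (forall v w, f v w = g v w) -> tlift f =1 tlift g.
Proof.
by move=> fg t; apply: eq_bigr => i _; apply: eq_bigr => j _; rewrite fg.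
Qed.

Lemma tlift_fun (V W : vectType k) (U : lmodType k) (f g : V -> W -> U) a t :
  \sw_(v, w <- t) (a *: f v w + g v w) = a *: tlift f t + tlift g t.
Proof.
rewrite /tlift scaler_sumr -big_split; apply: eq_bigr => i _ /=.
rewrite scaler_sumr -big_split; apply: eq_bigr => j _ /=.
by rewrite scalerDr !scalerA mulrC.
Qed.

Lemma tlift_tens (V W : vectType k) : tlift (@tens k V W) =1 id.
Proof. by move=> t; rewrite [RHS]tens_sum. Qed.

End TensorTheory.

Section TensorAlg.
Variables (k : fieldType) (A B : falgType k).

Definition tmul (t u : tensor A B) : tensor A B :=
  \sw_(a, b <- t) \sw_(a', b' <- u) ((a * a') ⊗ (b * b')).

Fact tmul_linl u : linear (tmul^~ u).
Proof. by move=> a t t'; rewrite /tmul linearP. Qed.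

Fact tmul_linr t : linear (tmul t).
Proof.
move=> a u u'; rewrite /tmul -tlift_fun.
by apply: eq_tlift => b c; rewrite linearP.
Qed.

Fact tmul_pure (a a' : A) (b b' : B) : tmul (a ⊗ b) (a' ⊗ b') = (a * a') ⊗ (b * b').
Proof.
rewrite /tmul tlift_pure ?tlift_pure //; split=> [x c y z|x c y z].
- by rewrite mulrDr -scalerAr tensDl.
- by rewrite mulrDr -scalerAr tensDr.
- rewrite -tlift_fun; apply: eq_tlift => a1 b1.
  by rewrite mulrDl -scalerAl tensDl.
- rewrite -tlift_fun; apply: eq_tlift => a1 b1.
  by rewrite mulrDl -scalerAl tensDr.
Qed.

Fact tmulA : associative tmul.
Proof.
move=> x y z; move: x.
apply: tens_ext => [c x x'|c x x'|a b]; rewrite ?tmul_linl //.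
move: y; apply: tens_ext => [c y y'|c y y'|a' b'].
- by rewrite tmul_linl tmul_linr.
- by rewrite tmul_linr tmul_linl.
move: z; apply: tens_ext => [c z z'|c z z'|a'' b'']; rewrite ?tmul_linr //.
by rewrite !tmul_pure !mulrA.
Qed.

Fact tmul1t : left_id (1 ⊗ 1) tmul.
Proof.
apply: tens_ext => [c x x'|c x x'|a b]; rewrite ?tmul_linr //.
by rewrite tmul_pure !mul1r.
Qed.

Fact tmult1 : right_id (1 ⊗ 1) tmul.
Proof.
apply: tens_ext => [c x x'|c x x'|a b]; rewrite ?tmul_linl //.
by rewrite tmul_pure !mulr1.
Qed.

Fact tmulDl : left_distributive tmul +%R.
Proof. by move=> x y z; rewrite -[x]scale1r tmul_linl !scale1r. Qed.

Fact tmulDr : right_distributive tmul +%R.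
Proof. by move=> x y z; rewrite -[y]scale1r tmul_linr !scale1r. Qed.

Fact tone_neq0 : (1 : A) ⊗ (1 : B) != 0.
Proof.
apply/eqP => /matrixP t0.
have /rV0Pn[i ai] : v2r (1 : A) != 0
  by apply: contra_neq (oner_neq0 A) => v0; rewrite -[1]v2rK v0 linear0.
have /rV0Pn[j bj] : v2r (1 : B) != 0
  by apply: contra_neq (oner_neq0 B) => v0; rewrite -[1]v2rK v0 linear0.
have := t0 i j; rewrite !mxE big_ord1 mxE => /eqP.
by rewrite mulf_eq0 (negPf ai) (negPf bj).
Qed.

HB.instance Definition _ := GRing.Zmodule_isNzRing.Build (tensor A B)
  tmulA tmul1t tmult1 tmulDl tmulDr tone_neq0.

Fact tscaleAl (c : k) (x y : tensor A B) : c *: (x * y) = c *: x * y.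
Proof.
have t0 : 0 * y = 0 :> tensor A B by rewrite mul0r.
have := tmul_linl y c x 0; rewrite -![tmul _ _]/(_ * y) t0 !addr0 => ->; by [].
Qed.

Fact tscaleAr (c : k) (x y : tensor A B) : c *: (x * y) = x * (c *: y).
Proof.
have t0 : x * 0 = 0 by rewrite mulr0.
have := tmul_linr x c y 0; rewrite -![tmul _ _]/(x * _) t0 !addr0 => ->; by [].
Qed.

HB.instance Definition _ := GRing.Lmodule_isLalgebra.Build k (tensor A B) tscaleAl.
HB.instance Definition _ := GRing.Lalgebra_isAlgebra.Build k (tensor A B) tscaleAr.
HB.instance Definition _ := Algebra_isFalgebra.Build k (tensor A B).

Lemma tensM (a a' : A) (b b' : B) : (a ⊗ b) * (a' ⊗ b') = (a * a') ⊗ (b * b').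
Proof. exact: tmul_pure. Qed.

Lemma tens1 : (1 : A) ⊗ (1 : B) = 1.
Proof. by []. Qed.

End TensorAlg.

(* The algebra with generators e_i (i < m) and relations e_i^2 = q i and
   e_i e_j + e_j e_i = b i j (i < j; the other values of b are irrelevant), built
   inside a matrix algebra.  If C' is the algebra on e_1, .., e_(m-1), then
   C = C' ⊕ e_0 C' and in this decomposition left multiplication acts by
     e_0 (u + e_0 v) = q 0 v + e_0 u
     e_i (u + e_0 v) = (e_i u + b 0 i v) - e_0 (e_i v)      (i > 0);
   [cgen] is the resulting left regular representation on k^(2^m) and
   [clifford] the subalgebra it generates.  That this is the algebra presented by
   the relations is proved in [cl_clrel], [clhom_gen], [clhom_uniq] (universal
   property) and [cl_dim] (dimension 2^m). *)
Section Clifford.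
Variable k : fieldType.

(* cdim m = 2 ^ m - 1, so that (cdim m).+1 is convertible to a successor, as the
   ring structure on square matrices requires. *)
Fixpoint cdim m : nat := if m is m'.+1 then (cdim m' + (cdim m').+1)%N else 0%N.

Lemma cdimE m : (cdim m).+1 = (2 ^ m)%N.
Proof. by elim: m => //= m IH; rewrite -addSn IH expnS mul2n addnn. Qed.

Fixpoint cgen m : ('I_m -> k) -> ('I_m -> 'I_m -> k) -> 'I_m -> 'M[k]_((cdim m).+1) :=
  match m with
  | 0 => fun _ _ _ => 0
  | m'.+1 => fun q b i =>
    if unlift ord0 i is Some j then
      let L := cgen (fun i => q (lift ord0 i))
                    (fun i j => b (lift ord0 i) (lift ord0 j)) j in
      (block_mx L (b ord0 i)%:M 0 (- L) : 'M_((cdim m').+1 + (cdim m').+1))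
    else (block_mx 0 (q ord0)%:M 1%:M 0 : 'M_((cdim m').+1 + (cdim m').+1))
  end.

Definition clifford m (q : 'I_m -> k) (b : 'I_m -> 'I_m -> k) : falgType k :=
  subvs_of (agenv_aspace <<[seq cgen q b i | i <- enum 'I_m]>>).

Definition clgen m (q : 'I_m -> k) (b : 'I_m -> 'I_m -> k) (i : 'I_m) :
  clifford q b := vsproj _ (cgen q b i).

(* [cev act z] maps the coordinates of a = \sum_P a_P e_P (P ordered increasingly)
   to \sum_P a_P act_P z, and [cvac] is the coordinate vector of 1. *)
Fixpoint cev m (M : lmodType k) :
    ('I_m -> M -> M) -> M -> 'cV[k]_((cdim m).+1) -> M :=
  match m with
  | 0 => fun _ z v => v 0 0 *: z
  | m'.+1 => fun act z v =>
    let v' : 'cV_((cdim m').+1 + (cdim m').+1) := v in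
    let act' i := act (lift ord0 i) in
    cev act' z (usubmx v') + act ord0 (cev act' z (dsubmx v'))
  end.

Fixpoint cvac m : 'cV[k]_((cdim m).+1) :=
  if m is m'.+1 then (col_mx (cvac m') 0 : 'cV_((cdim m').+1 + (cdim m').+1))
  else 1.

Definition cllift m (q : 'I_m -> k) (b : 'I_m -> 'I_m -> k) (M : lmodType k)
    (act : 'I_m -> M -> M) (z : M) (a : clifford q b) : M :=
  cev act z (vsval a *m cvac m).

Definition clact m (q : 'I_m -> k) (b : 'I_m -> 'I_m -> k) (M : lmodType k)
    (act : 'I_m -> M -> M) : Prop :=
  [/\ forall i, linear (act i),
      forall i v, act i (act i v) = q i *: v
    & forall (i j : 'I_m) v, (i < j)%N -> act i (act j v) + act j (act i v) = b i j *: v].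

Lemma cev_linear m (M : lmodType k) (act : 'I_m -> M -> M) z :
  (forall i, linear (act i)) -> linear (cev act z).
Proof.
elim: m act => [|m IH] act la a u v; first by rewrite /= !mxE scalerDl scalerA.
rewrite /= !linearP !IH // la scalerDr !addrA; congr (_ + _).
by rewrite -!addrA; congr (_ + _); rewrite addrC.
Qed.

Lemma cev_vac m (M : lmodType k) (act : 'I_m -> M -> M) z :
  (forall i, linear (act i)) -> cev act z (cvac m) = z.
Proof.
elim: m act => [|m IH] act la /=; first by rewrite mxE eqxx scale1r.
rewrite col_mxKu col_mxKd IH //.
by rewrite (lin0 (cev_linear z _)) // (lin0 (la _)) addr0.
Qed.

Lemma cev_act m q b (M : lmodType k) (act : 'I_m -> M -> M) z :
  clact q b act -> forall i v, cev act z (cgen q b i *m v) = act i (cev act z v).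
Proof.
elim: m q b act => [|m IH] q b act [la a2 aa] i v; first by case: i.
pose q' i := q (lift ord0 i).
pose b' i j := b (lift ord0 i) (lift ord0 j).
pose act' i := act (lift ord0 i).
have act'P : clact q' b' act'.
  by split=> [j|j u|j1 j2 u lt_j]; [exact: la | exact: a2 | apply: aa].
have la' := cev_linear z (let: And3 l _ _ := act'P in l).
have cZ := linZ la'; have cD := linD la'.
have aZ j := linZ (la j); have aD j := linD (la j).
rewrite -[v](@vsubmxK _ (cdim m).+1 (cdim m).+1 1).
set u := usubmx _; set w := dsubmx _.
have evE x y : cev act z (col_mx x y : 'cV_((cdim m).+1 + (cdim m).+1)) =
    cev act' z x + act ord0 (cev act' z y).
  by rewrite /= col_mxKu col_mxKd.
rewrite [cgen q b i]/=; case: unliftP => [j ->|->].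
  rewrite [_ *m _](@mul_block_col _ (cdim m).+1 (cdim m).+1 (cdim m).+1 (cdim m).+1 1).
  rewrite !evE mul0mx add0r mul_scalar_mx mulNmx -scaleN1r cZ !cD !IH // cZ.
  rewrite aZ scaleN1r aD -addrA; congr (_ + _).
  by rewrite -(aa ord0 (lift ord0 j)) // [X in X + _]addrC addrK.
rewrite [_ *m _](@mul_block_col _ (cdim m).+1 (cdim m).+1 (cdim m).+1 (cdim m).+1 1).
by rewrite !evE !mul0mx mul1mx addr0 add0r mul_scalar_mx cZ aD a2 addrC.
Qed.

Lemma cgen_act m q b :
  [/\ forall i : 'I_m, cgen q b i *m cgen q b i = (q i)%:M
    & forall i j : 'I_m, (i < j)%N ->
       cgen q b i *m cgen q b j + cgen q b j *m cgen q b i = (b i j)%:M].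
Proof.
elim: m q b => [|m IH] q b; first by split=> -[].
have [IH2 IHb] := IH (fun i => q (lift ord0 i))
                    (fun i j => b (lift ord0 i) (lift ord0 j)).
have mE := @mulmx_block k (cdim m).+1 (cdim m).+1 (cdim m).+1 (cdim m).+1 (cdim m).+1 (cdim m).+1.
have dE := @add_block_mx k (cdim m).+1 (cdim m).+1 (cdim m).+1 (cdim m).+1.
have sE (a : k) : a%:M = block_mx a%:M 0 0 a%:M :> 'M_((cdim m).+1 + (cdim m).+1).
  exact: scalar_mx_block.
split=> [i|i j]; rewrite /=.
  case: unliftP => [j ->|->]; rewrite [LHS]mE [RHS]sE.
    rewrite !mul0mx !mulmx0 mul_scalar_mx mul_mx_scalar scalerN subrr.
    by rewrite mulmxN mulNmx opprK !addr0 add0r IH2.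
  by rewrite !mul0mx !mulmx0 mul1mx mulmx1 !addr0 !add0r.
case: (unliftP ord0 j) => [j' ->|-> //].
case: (unliftP ord0 i) => [i' ->|->] lt_ij.
  rewrite [X in X + _]mE [X in _ + X]mE [LHS]dE [RHS]sE.
  rewrite !mul0mx !mulmx0 !mul_scalar_mx !mul_mx_scalar !mulmxN !mulNmx !opprK.
  rewrite !addr0 !add0r IHb //.
  by rewrite !scalerN addrA subrK subrr.
rewrite [X in X + _]mE [X in _ + X]mE [LHS]dE [RHS]sE.
rewrite !mul0mx !mulmx0 !mul1mx !mulmx1 !mul_scalar_mx !mul_mx_scalar.
by rewrite !addr0 !add0r scalerN ?subrr ?addNr.
Qed.

Lemma cev_id m q b N (j : 'cV[k]_((cdim m).+1) -> 'cV[k]_N)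
    (Y : 'I_m -> 'M[k]_N) : linear j ->
  (forall i v, j (cgen q b i *m v) = Y i *m j v) ->
  forall v, cev (fun i => mulmx (Y i)) (j (cvac m)) v = j v.
Proof.
elim: m q b j Y => [|m IH] q b j Y lj jY v.
  have jZ := linZ lj.
  rewrite /= -jZ; congr j; apply/matrixP => x y.
  by rewrite !mxE !ord1 eqxx mulr1.
have jD := linD lj.
rewrite /=; set u := usubmx _; set w := dsubmx _.
pose j' (x : 'cV[k]_((cdim m).+1)) : 'cV_N :=
  j (col_mx x 0 : 'cV_((cdim m).+1 + (cdim m).+1)).
have cE := @mul_block_col k (cdim m).+1 (cdim m).+1 (cdim m).+1 (cdim m).+1 1.
have lj' : linear j'.
  move=> a x y; rewrite /j' -lj; congr j.
  have -> : col_mx (a *: x + y) 0 = col_mx (a *: x) (a *: 0) + col_mx y 0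
      :> 'cV_((cdim m).+1 + (cdim m).+1) by rewrite scaler0 add_col_mx addr0.
  by rewrite -scale_col_mx.
have j'Y i x : j' (cgen (fun i => q (lift ord0 i))
    (fun i j => b (lift ord0 i) (lift ord0 j)) i *m x) = Y (lift ord0 i) *m j' x.
  rewrite /j' -jY /= liftK [X in _ = j X]cE.
  by rewrite mul0mx !mulmx0 !addr0.
rewrite !(IH _ _ j' (fun i => Y (lift ord0 i)) lj' j'Y) -jY -jD; congr j.
rewrite /= unlift_none [X in _ + X = _]cE !mul0mx !mulmx0 mul1mx !addr0.
by apply: etrans (add_col_mx u 0 0 w) _; rewrite addr0 add0r vsubmxK.
Qed.

End Clifford.

Lemma cev_nat (k : fieldType) m (M N : lmodType k) (F : M -> N)
    (act : 'I_m -> M -> M) (act' : 'I_m -> N -> N) z : linear F ->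
  (forall i x, F (act i x) = act' i (F x)) ->
  forall v, F (cev act z v) = cev act' (F z) v.
Proof.
move=> lF; elim: m act act' => [|m IH] act act' Fa v /=; first exact: linZ.
rewrite linD // Fa; congr (_ + act' _ _); exact: (IH _ (fun i => act' (lift ord0 i))).
Qed.

Lemma agenv_ind (k : fieldType) (aT : falgType k) (X : seq aT) (P : aT -> Prop) :
  P 1 -> (forall c u v, P u -> P v -> P (c *: u + v)) ->
  {in X, forall x v, P v -> P (x * v)} ->
  {in agenv <<X>>, forall a, P a}.
Proof.
move=> P1 Pl PX.
have P0 : P 0 by have := Pl (-1) _ _ P1 P1; rewrite scaleN1r addNr.
have PZ c u : P u -> P (c *: u) by move=> Pu; rewrite -[_ *: _]addr0; apply: Pl.
have PD u v : P u -> P v -> P (u + v) by move=> Pu; rewrite -[u]scale1r; apply: Pl.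
have Pspan (Y : seq aT) : {in Y, forall x, P x} -> {in <<Y>>%VS, forall a, P a}.
  move=> PY a; rewrite -[Y]/(tval (in_tuple Y)) => /coord_span ->.
  by apply: big_ind => // i _; apply/PZ/PY/mem_nth.
have Pexp i : {in (<<X>> ^+ i)%VS, forall a, P a}.
  elim: i => [|i IH] a; first by rewrite expv0 => /vlineP[c ->]; apply: PZ.
  rewrite expvSl [@prodv _ _]unlock; apply: Pspan => _ /allpairsP[[u v] /= [Uu Uv ->]].
  have {Uu} : u \in <<X>>%VS by apply: vbasis_mem.
  have {Uv} /IH Pv : v \in (<<X>> ^+ i)%VS by apply: vbasis_mem.
  rewrite -[X in <<X>>%VS]/(tval (in_tuple X)) => /coord_span ->.
  rewrite mulr_suml; apply: big_ind => // j _.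
  by rewrite -scalerAl; apply/PZ/PX => //; apply: mem_nth.
move=> a /memv_sumP[f Pf ->]; apply: big_ind => // i _; apply: (Pexp i).
exact: Pf.
Qed.

Section CliffordTheory.
Variables (k : fieldType) (m : nat) (q : 'I_m -> k) (b : 'I_m -> 'I_m -> k).
Local Notation C := (clifford q b).
Implicit Type a : C.

Lemma val_clgen i : vsval (clgen q b i) = cgen q b i.
Proof.
apply: vsprojK; apply: (subvP (sub_agenv _)).
exact: memv_span (map_f _ (mem_enum _ i)).
Qed.

Lemma val_cl1 : vsval (1 : C) = 1.
Proof. by apply/eqP; rewrite [_ == _]algid_eq1 memvE sub1_agenv. Qed.

Lemma val_clM a a' : vsval (a * a') = vsval a * vsval a'.
Proof. by []. Qed.

Lemma val_clZ c a : vsval (c *: a) = c *: vsval a.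
Proof.
have vl : linear (vsval : subvs_of (agenv_aspace <<[seq cgen q b i | i <- enum 'I_m]>>) -> _) by exact: linearP.
by have := linZ vl c a. Qed.

Lemma val_clD a a' : vsval (a + a') = vsval a + vsval a'.
Proof. by []. Qed.

Lemma clgen2 i : clgen q b i * clgen q b i = (q i)%:A.
Proof.
apply: val_inj; rewrite [LHS]val_clM [RHS]val_clZ val_cl1 val_clgen.
have [e2 _] := cgen_act q b.
by rewrite -[LHS]/(_ *m _) e2 -scalemx1.
Qed.

Lemma clgenC (i j : 'I_m) : (i < j)%N ->
  clgen q b i * clgen q b j + clgen q b j * clgen q b i = (b i j)%:A.
Proof.
move=> lt_ij; apply: val_inj.
rewrite [LHS]val_clD !val_clM [RHS]val_clZ val_cl1 !val_clgen.
have [_ eC] := cgen_act q b.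
by rewrite -[LHS]/(_ *m _ + _ *m _) eC // -scalemx1.
Qed.

Lemma cl_ind (P : C -> Prop) :
  P 1 -> (forall c u v, P u -> P v -> P (c *: u + v)) ->
  (forall i a, P a -> P (clgen q b i * a)) -> forall a, P a.
Proof.
move=> P1 Pl PX a.
pose Q x := exists2 a, vsval a = x & P a.
suff [a' eq_a Pa'] : Q (vsval a) by rewrite -(val_inj eq_a).
apply: (agenv_ind (P := Q)) (subvsP a); first by exists 1; rewrite ?val_cl1.
  move=> c _ _ [u <- Pu] [v <- Pv].
  by exists (c *: u + v); [rewrite val_clD val_clZ | apply: Pl].
move=> _ /mapP[i _ ->] _ [v <- Pv]; exists (clgen q b i * v); last exact: PX.
by rewrite [LHS]val_clM val_clgen.
Qed.

Section Lift.
Variables (M : lmodType k) (act : 'I_m -> M -> M) (z : M).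
Hypothesis actP : clact q b act.
Let la : forall i, linear (act i). Proof. by have [] := actP. Qed.

Lemma cllift_linear : linear (cllift act z : C -> M).
Proof.
move=> c u v; rewrite /cllift val_clD val_clZ mulmxDl -scalemxAl.
exact: cev_linear.
Qed.

Lemma cllift1 : cllift act z (1 : C) = z.
Proof. by rewrite /cllift val_cl1 [_ *m _]mul1mx cev_vac. Qed.

Lemma clliftM i a : cllift act z (clgen q b i * a) = act i (cllift act z a).
Proof.
by rewrite /cllift val_clM val_clgen -[_ * _]/(_ *m _) -mulmxA (cev_act z actP).
Qed.

End Lift.

Definition clrel (B : algType k) (y : 'I_m -> B) : Prop :=
  (forall i, y i * y i = (q i)%:A) /\
  (forall i j : 'I_m, (i < j)%N -> y i * y j + y j * y i = (b i j)%:A).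

Lemma clrel_actl (B : algType k) (y : 'I_m -> B) :
  clrel y -> clact q b (fun i => *%R (y i)).
Proof.
case=> y2 yC; split=> [i c u v|i v|i j v lt_ij].
- by rewrite mulrDr scalerAr.
- by rewrite mulrA y2 -scalerAl mul1r.
- by rewrite !mulrA -mulrDl yC // -scalerAl mul1r.
Qed.

Lemma clrel_actr (B : algType k) (y : 'I_m -> B) :
  clrel y -> clact q b (fun i v => v * y i).
Proof.
case=> y2 yC; split=> [i c u v|i v|i j v lt_ij].
- by rewrite mulrDl scalerAl.
- by rewrite -mulrA y2 -scalerAr mulr1.
- by rewrite -!mulrA -mulrDr addrC yC // -scalerAr mulr1.
Qed.

Lemma cl_clrel : clrel (clgen q b).
Proof. by split; [exact: clgen2 | exact: clgenC]. Qed.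

Definition linhom (V W : vectType k) (f : V -> W) (lf : linear f) : 'Hom(V, W) :=
  linfun (HB.pack f (GRing.isSemilinear.Build k V W _ f
    (GRing.semilinear_linear lf)) : {linear V -> W}).

Lemma linhomE (V W : vectType k) (f : V -> W) (lf : linear f) : linhom lf =1 f.
Proof. by move=> v; rewrite lfunE. Qed.

Section Hom.
Variables (B : falgType k) (y : 'I_m -> B).
Hypothesis yrel : clrel y.

Definition clhom_lin : 'Hom(C, B) :=
  linhom (cllift_linear 1 (clrel_actl yrel)).

Fact clhom_ahom : ahom_in fullv clhom_lin.
Proof.
apply/ahom_inP; split=> [a a' _ _|]; rewrite !linhomE; last first.
  by rewrite cllift1 //; apply: clrel_actl.
move: a; apply: cl_ind => [|c u v eu ev|i a ea].
- by rewrite cllift1 ?mul1r //; apply: clrel_actl.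
- have l := cllift_linear 1 (clrel_actl yrel).
  by rewrite mulrDl -scalerAl !l eu ev mulrDl scalerAl.
- by rewrite -mulrA !(clliftM 1 (clrel_actl yrel)) ea mulrA.
Qed.

Definition clhom : 'AHom(C, B) := AHom clhom_ahom.

Lemma clhom_gen i : clhom (clgen q b i) = y i.
Proof.
rewrite [LHS]linhomE -[clgen q b i]mulr1 (clliftM 1 (clrel_actl yrel)).
by rewrite cllift1 ?mulr1 //; apply: clrel_actl.
Qed.

Lemma clhom_uniq (f f' : 'AHom(C, B)) :
  (forall i, f (clgen q b i) = f' (clgen q b i)) -> f =1 f'.
Proof.
move=> ff'; apply: cl_ind => [|c u v eu ev|i a ea]; first by rewrite !rmorph1.
  by rewrite [LHS]linearP [RHS]linearP; congr (_ *: _ + _).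
by rewrite !rmorphM /= ff' ea.
Qed.

End Hom.

Lemma cl_dim : \dim {:C} = (2 ^ m)%N.
Proof.
pose phi a := vsval a *m cvac k m.
have lphi : linear phi by move=> c u v; rewrite /phi val_clD val_clZ mulmxDl -scalemxAl.
pose psi := cev (fun i => *%R (clgen q b i)) (1 : C).
have phiK : cancel phi psi.
  apply: (cl_ind (P := fun a => psi (phi a) = a)) => [|c u v eu ev|i a ea].
  - exact: (cllift1 _ (clrel_actl cl_clrel)).
  - rewrite lphi -[in RHS]eu -[in RHS]ev.
    by rewrite [LHS]cev_linear //; have [] := clrel_actl cl_clrel.
  - by rewrite -[in RHS]ea -[LHS]/(cllift _ _ _) (clliftM _ (clrel_actl cl_clrel)).
have psiK : cancel psi phi.
  move=> v; rewrite /psi (cev_nat (act' := fun i => mulmx (cgen q b i)) _ lphi).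
    have -> : phi 1 = id (cvac k m) by rewrite /phi val_cl1 mul1mx.
    exact: (cev_id (q := q) (b := b) (j := id)).
  by move=> i a; rewrite /phi val_clM val_clgen mulmxA.
pose F := linhom lphi.
have /eqP kF : lker F == 0%VS.
  by apply/lker0P=> u v; rewrite !linhomE; apply: (can_inj phiK).
have iF : limg F = fullv.
  apply/vspaceP=> v; rewrite memvf; apply/memv_imgP; exists (psi v).
    exact: memvf.
  by rewrite linhomE psiK.
have := limg_ker_dim F fullv; rewrite kF capv0 dimv0 add0n iF => <-.
by rewrite dimvf /dim /= muln1 cdimE.
Qed.

End CliffordTheory.

Lemma tlift_mul (k : fieldType) (A B C : falgType k) (f : A -> B -> C) :
  bilin f -> (forall a a' b b', f (a * a') (b * b') = f a b * f a' b') ->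
  {morph tlift f : t u / t * u}.
Proof.
move=> bf fM t u; move: t; apply: tens_ind => [c t t' e1 e2|a b].
  by rewrite mulrDl -scalerAl !tlift_linear e1 e2 mulrDl -scalerAl.
move: u; apply: tens_ind => [c t t' e1 e2|a' b'].
  by rewrite mulrDr -scalerAr !tlift_linear e1 e2 mulrDr -scalerAr.
by rewrite tensM !tlift_pure.
Qed.

(* [antipode_bij] is the standing assumption that the antipode is bijective, not a
   Hopf algebra axiom. *)
Record hopf (k : fieldType) (H : falgType k) := Hopf {
  comul : 'AHom(H, tensor H H);
  counit : 'AHom(H, k^o);
  antipode : 'End(H);
  comulA : forall h,
    \sw_(a, b <- comul h) (comul a ⊗ b) =
    \sw_(a, b <- comul h) \sw_(c, d <- comul b) (a ⊗ c ⊗ d);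
  comul_counitl : forall h, \sw_(a, b <- comul h) (counit a *: b) = h;
  comul_counitr : forall h, \sw_(a, b <- comul h) (counit b *: a) = h;
  antipodel : forall h, \sw_(a, b <- comul h) (antipode a * b) = (counit h)%:A;
  antipoder : forall h, \sw_(a, b <- comul h) (a * antipode b) = (counit h)%:A;
  antipode_bij : bijective antipode
}.

Record comodalg (k : fieldType) (H : falgType k) (hs : hopf H) (A : falgType k) :=
  ComodAlg {
  coact : 'AHom(A, tensor A H);
  coactA : forall a,
    \sw_(b, h <- coact a) (coact b ⊗ h) =
    \sw_(b, h <- coact a) \sw_(h1, h2 <- comul hs h) (b ⊗ h1 ⊗ h2);
  coact_counit : forall a, \sw_(b, h <- coact a) (counit hs h *: b) = a
}.

Section Integral.
Variables (k : fieldType) (H : falgType k) (hs : hopf H).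
Variables (A : falgType k) (cs : comodalg hs A).

Local Notation Δ := (comul hs).
Local Notation ρ := (coact cs).
(* the inverse of the antipode, which is bijective by [antipode_bij] *)
Local Notation S' := (antipode hs)^-1%VF.

(* An integral takes its values in A ⊗ H^op, whose underlying space is A ⊗ H; all
   products below are those of A ⊗ H, i.e. H carries its own multiplication. *)
Definition is_integral (T : 'Hom(H, tensor A H)) : Prop :=
  (forall h : H,
     \sw_(h1, h2 <- Δ h) \sw_(a, l <- T h2)
       \sw_(a0, a1 <- ρ a) \sw_(l1, l2 <- Δ l) (a0 ⊗ l1 ⊗ (l2 * h1 * a1))
     = T h ⊗ 1)
  /\
  (forall (a : A) (h : H),
     \sw_(a0, b <- ρ a) \sw_(a1, c <- Δ b) \sw_(a2, a3 <- Δ c)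
       ((a0 ⊗ 1) * T (S' a2 * h * a1) * (1 ⊗ S' a3))
     = \sw_(a0, a1 <- ρ a) ((1 ⊗ S' a1) * T h * (a0 ⊗ 1))).

Definition is_total_integral (T : 'Hom(H, tensor A H)) : Prop :=
  is_integral T /\ T 1 = 1 ⊗ 1.

Definition id_counit (t : tensor A H) : A := \sw_(a, h <- t) (counit hs h *: a).

Definition h_property (T : 'Hom(H, tensor A H)) : Prop :=
  forall h h' : H, id_counit (T h * T h') = id_counit (T (h' * h)).

End Integral.

(* Cl(alpha, beta_i, gamma_i, lambda_ij): the generators are G (index 0 of
   'I_n.+1) and X_i (index i + 1).  The values lambda i j are used for i < j only.
   The presentation is [Cl_relP] and [Cl_universal], the dimension is [Cl_dim]. *)
Section Cl.
Variables (k : fieldType) (n : nat).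

Definition Cl_sq (alpha : k) (beta : 'I_n -> k) (i : 'I_n.+1) : k :=
  if unlift ord0 i is Some i' then beta i' else alpha.

Definition Cl_anti (gamma : 'I_n -> k) (lambda : 'I_n -> 'I_n -> k)
    (i j : 'I_n.+1) : k :=
  match unlift ord0 i, unlift ord0 j with
  | None, Some j' => gamma j'
  | Some i', Some j' => lambda i' j'
  | _, None => 0
  end.

Definition Cl (alpha : k) (beta gamma : 'I_n -> k) (lambda : 'I_n -> 'I_n -> k) :
  falgType k := clifford (Cl_sq alpha beta) (Cl_anti gamma lambda).

(* As an algebra, E(n) is the case alpha = 1, beta = gamma = lambda = 0. *)
Definition En : falgType k := Cl 1 (fun _ => 0) (fun _ => 0) (fun _ _ => 0).

Section Gen.
Variables (alpha : k) (beta gamma : 'I_n -> k) (lambda : 'I_n -> 'I_n -> k).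
Local Notation A := (Cl alpha beta gamma lambda).

Definition Cl_G : A := clgen _ _ ord0.
Definition Cl_X (i : 'I_n) : A := clgen _ _ (lift ord0 i).

Definition Cl_rel (B : algType k) (G : B) (X : 'I_n -> B) : Prop :=
  [/\ G * G = alpha%:A,
      forall i, X i * X i = (beta i)%:A,
      forall i, G * X i + X i * G = (gamma i)%:A
    & forall i j : 'I_n, (i < j)%N -> X i * X j + X j * X i = (lambda i j)%:A].

Definition Cl_gen (B : Type) (G : B) (X : 'I_n -> B) (i : 'I_n.+1) : B :=
  if unlift ord0 i is Some i' then X i' else G.

Lemma Cl_gen0 (B : Type) (G : B) X : Cl_gen G X ord0 = G.
Proof. by rewrite /Cl_gen unlift_none. Qed.

Lemma Cl_genS (B : Type) (G : B) X i : Cl_gen G X (lift ord0 i) = X i.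
Proof. by rewrite /Cl_gen liftK. Qed.

Lemma Cl_gen_rel (B : algType k) (G : B) X : Cl_rel G X ->
  clrel (Cl_sq alpha beta) (Cl_anti gamma lambda) (Cl_gen G X).
Proof.
case=> rG rX rGX rXX; split=> [i|i j]; rewrite /Cl_gen /Cl_sq /Cl_anti.
  by case: unliftP.
case: (unliftP ord0 j) => [j' ->|-> //].
by case: (unliftP ord0 i) => [i' ->|->] // lt_ij; apply: rXX.
Qed.

Lemma Cl_relP : Cl_rel Cl_G Cl_X.
Proof.
split=> [|i|i|i j lt_ij].
- by rewrite [LHS]clgen2 /Cl_sq unlift_none.
- by rewrite [LHS]clgen2 /Cl_sq liftK.
- by rewrite [LHS]clgenC // /Cl_anti unlift_none liftK.
- by rewrite [LHS]clgenC // /Cl_anti !liftK.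
Qed.

Lemma Cl_dim : \dim {:A} = (2 ^ n.+1)%N.
Proof. exact: cl_dim. Qed.

Lemma Cl_ind (P : A -> Prop) :
  P 1 -> (forall c u v, P u -> P v -> P (c *: u + v)) ->
  (forall a, P a -> P (Cl_G * a)) -> (forall i a, P a -> P (Cl_X i * a)) ->
  forall a, P a.
Proof.
move=> P1 Pl PG PX; apply: cl_ind => // i a Pa.
by case: (unliftP ord0 i) => [j ->|->]; [apply: PX | apply: PG].
Qed.

Section Hom.
Variables (B : falgType k) (G : B) (X : 'I_n -> B).
Hypothesis rel : Cl_rel G X.

Definition Cl_hom : 'AHom(A, B) := clhom (Cl_gen_rel rel).

Lemma Cl_homG : Cl_hom Cl_G = G.
Proof. by rewrite [LHS]clhom_gen Cl_gen0. Qed.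

Lemma Cl_homX i : Cl_hom (Cl_X i) = X i.
Proof. by rewrite [LHS]clhom_gen Cl_genS. Qed.

(* the anti-multiplicative extension of G, X: see [Cl_antihomM] *)
Definition Cl_antihom : 'Hom(A, B) :=
  linhom (cllift_linear 1 (clrel_actr (Cl_gen_rel rel))).

Lemma Cl_antihom1 : Cl_antihom 1 = 1.
Proof. by rewrite linhomE cllift1 //; apply: (clrel_actr (Cl_gen_rel rel)). Qed.

Let gM i u : Cl_antihom (clgen _ _ i * u) = Cl_antihom u * Cl_gen G X i.
Proof. by rewrite !linhomE (clliftM 1 (clrel_actr (Cl_gen_rel rel))). Qed.

Lemma Cl_antihomM a a' : Cl_antihom (a * a') = Cl_antihom a' * Cl_antihom a.
Proof.
move: a; apply: cl_ind => [|c u v eu ev|i a ea].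
- by rewrite Cl_antihom1 mul1r mulr1.
- have lS : linear Cl_antihom by exact: linearP.
  by rewrite mulrDl -scalerAl !lS eu ev mulrDr -scalerAr.
- by rewrite -mulrA !gM ea mulrA.
Qed.

Lemma Cl_antihomG : Cl_antihom Cl_G = G.
Proof.
by rewrite -[Cl_G]mulr1 [LHS]gM Cl_antihom1 mul1r Cl_gen0.
Qed.

Lemma Cl_antihomX i : Cl_antihom (Cl_X i) = X i.
Proof.
by rewrite -[Cl_X i]mulr1 [LHS]gM Cl_antihom1 mul1r Cl_genS.
Qed.

End Hom.

Lemma Cl_hom_ext (B : falgType k) (f f' : 'AHom(A, B)) :
  f Cl_G = f' Cl_G -> (forall i, f (Cl_X i) = f' (Cl_X i)) -> f =1 f'.
Proof.
move=> eG eX; apply: clhom_uniq => i.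
by case: (unliftP ord0 i) => [j ->|->]; [apply: eX | apply: eG].
Qed.

Lemma Cl_universal (B : falgType k) (G : B) (X : 'I_n -> B) : Cl_rel G X ->
  exists2 f : 'AHom(A, B), f Cl_G = G /\ forall i, f (Cl_X i) = X i
    & forall f' : 'AHom(A, B), f' Cl_G = G -> (forall i, f' (Cl_X i) = X i) -> f' =1 f.
Proof.
move=> rel; exists (Cl_hom rel).
  by split; [exact: Cl_homG | exact: Cl_homX].
move=> f' eG eX; apply: Cl_hom_ext => [|i]; first by rewrite eG Cl_homG.
by rewrite eX Cl_homX.
Qed.

End Gen.

Definition En_g : En := Cl_G _ _ _ _.
Definition En_x (i : 'I_n) : En := Cl_X _ _ _ _ i.

(* a big product over 'I_n runs through the indices in increasing order *)
Definition En_xP (P : {set 'I_n}) : En := \prod_(i in P) En_x i.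

Lemma En_g2 : En_g * En_g = 1.
Proof. by have [-> _ _ _] := Cl_relP 1 (fun _ => 0) (fun _ => 0) (fun _ _ => 0); rewrite scale1r. Qed.

Lemma En_x2 i : En_x i * En_x i = 0.
Proof. by have [_ -> _ _] := Cl_relP 1 (fun _ => 0) (fun _ => 0) (fun _ _ => 0); rewrite scale0r. Qed.

Lemma En_gx i : En_g * En_x i = - (En_x i * En_g).
Proof.
have [_ _ /(_ i) e _] := Cl_relP 1 (fun _ => 0) (fun _ => 0) (fun _ _ => 0).
by apply/eqP; rewrite -addr_eq0 [X in X == _]e scale0r.
Qed.

Lemma En_xx (i j : 'I_n) : (i < j)%N -> En_x i * En_x j = - (En_x j * En_x i).
Proof.
move=> lt_ij.
have [_ _ _ /(_ i j lt_ij) e] := Cl_relP 1 (fun _ => 0) (fun _ => 0) (fun _ _ => 0).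
by apply/eqP; rewrite -addr_eq0 [X in X == _]e scale0r.
Qed.

End Cl.

Lemma tens_Cl_rel (k : fieldType) (n : nat) (alpha : k) (beta gamma : 'I_n -> k)
    (lambda : 'I_n -> 'I_n -> k) (A H : falgType k)
    (G : A) (X : 'I_n -> A) (g : H) (x : 'I_n -> H) :
  Cl_rel alpha beta gamma lambda G X -> g * g = 1 ->
  (forall i, x i * x i = 0) -> (forall i, g * x i = - (x i * g)) ->
  (forall i j : 'I_n, (i < j)%N -> x i * x j = - (x j * x i)) ->
  Cl_rel alpha beta gamma lambda (G ⊗ g : tensor A H) (fun i => X i ⊗ g + 1 ⊗ x i).
Proof.
case=> rG rX rGX rXX g2 x2 gx xx.
split=> [|i|i|i j lt_ij].
- by rewrite tensM rG g2 tens_scalel.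
- rewrite mulrDl !mulrDr !tensM !mulr1 !mul1r rX g2 x2 gx tens_0r addr0.
  by rewrite -addrA -tens_addr addNr tens_0r addr0 tens_scalel.
- rewrite mulrDl !mulrDr !tensM !mulr1 !mul1r g2 addrACA.
  by rewrite -tens_addl -tens_addr gx addNr tens_0r addr0 rGX tens_scalel.
- rewrite !mulrDl !mulrDr !tensM !mulr1 !mul1r g2.
  rewrite (AC ((2*2)*(2*2)) ((1*5)*(2*7)*(3*6)*(4*8))) /=.
  rewrite -!tens_addl -!tens_addr rXX // (xx i j lt_ij) !gx !addNr subrr.
  by rewrite !tens_0r !addr0 tens_scalel.
Qed.

Section Coaction.
Variables (k : fieldType) (n : nat).
Variables (alpha : k) (beta gamma : 'I_n -> k) (lambda : 'I_n -> 'I_n -> k).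
Local Notation A := (Cl alpha beta gamma lambda).
Local Notation G := (Cl_G alpha beta gamma lambda).
Local Notation X := (Cl_X alpha beta gamma lambda).
Local Notation H := (En k n).
Local Notation g := (En_g k n).
Local Notation x := (@En_x k n).

Fact Cl_coact_rel : Cl_rel alpha beta gamma lambda
  (G ⊗ g : tensor A H) (fun i => X i ⊗ g + 1 ⊗ x i).
Proof.
apply: tens_Cl_rel; first exact: Cl_relP.
- exact: En_g2.
- exact: En_x2.
- exact: En_gx.
- exact: En_xx.
Qed.

Definition Cl_coact : 'AHom(A, tensor A H) := Cl_hom Cl_coact_rel.

Lemma Cl_coactG : Cl_coact G = G ⊗ g.
Proof. exact: Cl_homG. Qed.

Lemma Cl_coactX i : Cl_coact (X i) = X i ⊗ g + 1 ⊗ x i.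
Proof. exact: Cl_homX. Qed.

End Coaction.

Section EnHopf.
Variables (k : fieldType) (n : nat).
Local Notation H := (En k n).
Local Notation g := (En_g k n).
Local Notation x := (@En_x k n).

(* On the generators of E(n) the canonical coaction and the comultiplication are
   given by the same formulas, see [En_comulg] and [En_comulx]. *)
Definition En_comul : 'AHom(H, tensor H H) :=
  Cl_coact 1 (fun _ => 0) (fun _ => 0) (fun _ _ => 0).

Lemma En_comulg : En_comul g = g ⊗ g.
Proof. exact: Cl_coactG. Qed.

Lemma En_comulx i : En_comul (x i) = x i ⊗ g + 1 ⊗ x i.
Proof. exact: Cl_coactX. Qed.

Fact En_counit_rel : @Cl_rel k n 1 (fun _ => 0) (fun _ => 0) (fun _ _ => 0) k^o
  1 (fun _ => 0).
Proof.
by split=> [|i|i|i j _]; rewrite ?mul1r ?mulr0 ?mul0r ?addr0 ?scale1r ?scale0r.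
Qed.

Definition En_counit : 'AHom(H, k^o) := Cl_hom En_counit_rel.

Lemma En_counitg : En_counit g = 1.
Proof. exact: Cl_homG. Qed.

Lemma En_counitx i : En_counit (x i) = 0.
Proof. exact: Cl_homX. Qed.

Fact En_antipode_rel : Cl_rel 1 (fun _ => 0) (fun _ => 0) (fun _ _ => 0)
  g (fun i => g * x i).
Proof.
have g2 := En_g2 k n; have x2 := @En_x2 k n; have gx := @En_gx k n.
have xx := @En_xx k n.
have gxgx i j : (g * x i) * (g * x j) = - (x i * x j).
  by rewrite {1}gx mulNr -mulrA (mulrA g) g2 mul1r.
split=> [|i|i|i j lt_ij].
- by rewrite g2 scale1r.
- by rewrite gxgx x2 oppr0 scale0r.
- by rewrite -mulrA -mulrDr -[x i * g]opprK -gx subrr mulr0 scale0r.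
- by rewrite !gxgx (xx i j lt_ij) opprK subrr scale0r.
Qed.

Definition En_antipode : 'End(H) := Cl_antihom En_antipode_rel.

Lemma En_antipodeg : En_antipode g = g.
Proof. exact: Cl_antihomG. Qed.

Lemma En_antipodex i : En_antipode (x i) = g * x i.
Proof. exact: Cl_antihomX. Qed.

Lemma En_antipode1 : En_antipode 1 = 1.
Proof. exact: Cl_antihom1. Qed.

Lemma En_antipodeM h h' : En_antipode (h * h') = En_antipode h' * En_antipode h.
Proof. exact: Cl_antihomM. Qed.

Fact En_antipode_bij : bijective En_antipode.
Proof.
have lS : linear En_antipode by exact: linearP.
pose S := En_antipode : H -> H.
have SN h : S (- h) = - S h by exact: linearN.
have SS i : S (S (x i)) = - x i.
  by rewrite /S En_antipodex En_antipodeM En_antipodex En_antipodeg -mulrA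
             -[x i * g]opprK -En_gx mulrN mulrA En_g2 mul1r.
have S4 h : S (S (S (S h))) = h.
  move: h; apply: Cl_ind => [|c u v eu ev|u eu|i u eu].
  - by rewrite /S !En_antipode1.
  - by rewrite /S !lS -!/(S _) eu ev.
  - by rewrite /S !En_antipodeM !En_antipodeg -!/(S _) eu.
  - rewrite /S (En_antipodeM (x i) u) (En_antipodeM (S u)) (En_antipodeM _ (S (S u))).
    by rewrite (En_antipodeM (S (S (S u)))) -!/(S _) eu !SS !SN SS opprK.
by exists (S \o S \o S) => h /=; apply: S4.
Qed.

End EnHopf.

Section CoactTheory.
Variables (k : fieldType) (n : nat).
Variables (alpha : k) (beta gamma : 'I_n -> k) (lambda : 'I_n -> 'I_n -> k).
Local Notation A := (Cl alpha beta gamma lambda).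
Local Notation H := (En k n).
Local Notation ρ := (Cl_coact alpha beta gamma lambda).
Local Notation Δ := (En_comul k n).
Local Notation ε := (En_counit k n).

Fact Cl_coactA (a : A) :
  \sw_(b, h <- ρ a) (ρ b ⊗ h) =
  \sw_(b, h <- ρ a) \sw_(h1, h2 <- Δ h) (b ⊗ h1 ⊗ h2).
Proof.
have lr : linear ρ by exact: linearP.
have lD : linear Δ by exact: linearP.
pose F (b : A) (h : H) : tensor (tensor A H) H := ρ b ⊗ h.
have bF : bilin F.
  split=> [h c u v|b c u v]; rewrite /F; last by rewrite tensDr.
  by rewrite lr tensDl.
have FM a1 a2 b1 b2 : F (a1 * a2) (b1 * b2) = F a1 b1 * F a2 b2.
  by rewrite /F rmorphM tensM.
pose E (b : A) (t : tensor H H) : tensor (tensor A H) H :=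
  \sw_(h1, h2 <- t) (b ⊗ h1 ⊗ h2).
have bE b : bilin (fun h1 h2 : H => (b ⊗ h1 ⊗ h2)).
  by split=> [h c u v|h c u v]; rewrite ?tensDr // tensDl.
have Epure b h1 h2 : E b (h1 ⊗ h2) = b ⊗ h1 ⊗ h2 by rewrite /E tlift_pure.
have El b1 b2 c t : E (c *: b1 + b2) t = c *: E b1 t + E b2 t.
  by rewrite /E -tlift_fun; apply: eq_tlift => u v; rewrite !tensDl.
have EM b1 b2 t1 t2 : E (b1 * b2) (t1 * t2) = E b1 t1 * E b2 t2.
  move: t1; apply: tens_ind => [c u v eu ev|h1 h2].
    by rewrite mulrDl -scalerAl /E !tlift_linear -!/(E _ _) eu ev mulrDl -scalerAl.
  move: t2; apply: tens_ind => [c u v eu ev|h3 h4].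
    by rewrite mulrDr -scalerAr /E !tlift_linear -!/(E _ _) eu ev mulrDr -scalerAr.
  by rewrite tensM !Epure !tensM.
pose K (b : A) (h : H) := E b (Δ h).
have bK : bilin K.
  split=> [h c u v|b c u v]; rewrite /K; first exact: El.
  by rewrite lD /E tlift_linear.
have KM a1 a2 b1 b2 : K (a1 * a2) (b1 * b2) = K a1 b1 * K a2 b2.
  by rewrite /K rmorphM EM.
have LM := tlift_mul bF FM; have RM := tlift_mul bK KM.
rewrite -[LHS]/(tlift F (ρ a)) -[RHS]/(tlift K (ρ a)); move: a.
apply: Cl_ind => [|c u v eu ev|u eu|i u eu].
- rewrite [ρ 1]rmorph1 -tens1 !tlift_pure // /F /K.
  by rewrite [ρ 1]rmorph1 [Δ 1]rmorph1 -!tens1 Epure.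
- by rewrite lr !tlift_linear eu ev.
- rewrite rmorphM LM RM eu; congr (_ * _).
  by rewrite /= Cl_coactG !tlift_pure // /F /K Cl_coactG En_comulg Epure.
- rewrite rmorphM LM RM eu; congr (_ * _).
  rewrite /= Cl_coactX !(linD (@tlift_linear _ _ _ _ _)) !tlift_pure // /F /K.
  rewrite Cl_coactX [ρ 1]rmorph1 En_comulg En_comulx -tens1 Epure.
  rewrite /E (linD (@tlift_linear _ _ _ _ _)) -!/(E _ _) !Epure.
  by rewrite tens_addl addrA.
Qed.

Fact Cl_coact_counit (a : A) : \sw_(b, h <- ρ a) (ε h *: b) = a.
Proof.
have lr : linear ρ by exact: linearP.
have le : linear ε by exact: linearP.
pose F (b : A) (h : H) : A := (ε h : k) *: b.
have bF : bilin F.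
  split=> [h c u v|b c u v]; rewrite /F.
    by rewrite scalerDr !scalerA mulrC.
  by rewrite le scalerDl scalerA.
have FM a1 a2 b1 b2 : F (a1 * a2) (b1 * b2) = F a1 b1 * F a2 b2.
  by rewrite /F rmorphM -scalerAl -scalerAr scalerA.
have LM := tlift_mul bF FM.
rewrite -[LHS]/(tlift F (ρ a)); move: a.
apply: Cl_ind => [|c u v eu ev|u eu|i u eu].
- by rewrite [ρ 1]rmorph1 -tens1 tlift_pure // /F [ε 1]rmorph1 scale1r.
- by rewrite lr tlift_linear eu ev.
- by rewrite rmorphM LM eu /= Cl_coactG tlift_pure // /F En_counitg scale1r.
- rewrite rmorphM LM eu; congr (_ * _).
  rewrite /= Cl_coactX (linD (@tlift_linear _ _ _ _ _)) !tlift_pure // /F.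
  by rewrite En_counitg En_counitx scale1r scale0r addr0.
Qed.

End CoactTheory.

Section EnHopfTheory.
Variables (k : fieldType) (n : nat).
Local Notation H := (En k n).
Local Notation Δ := (En_comul k n).
Local Notation ε := (En_counit k n).
Local Notation S := (En_antipode k n).
Let lD : linear Δ. Proof. exact: linearP. Qed.
Let le : linear ε. Proof. exact: linearP. Qed.
Let lS : linear S. Proof. exact: linearP. Qed.

Fact En_counitl (a : H) : \sw_(b, h <- Δ a) (ε b *: h) = a.
Proof.
pose F (b h : H) : H := (ε b : k) *: h.
have bF : bilin F.
  split=> [h c u v|b c u v]; rewrite /F; last by rewrite scalerDr !scalerA mulrC.
  by rewrite le scalerDl scalerA.
have FM a1 a2 b1 b2 : F (a1 * a2) (b1 * b2) = F a1 b1 * F a2 b2.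
  by rewrite /F rmorphM -scalerAl -scalerAr scalerA.
have LM := tlift_mul bF FM.
rewrite -[LHS]/(tlift F (Δ a)); move: a.
apply: Cl_ind => [|c u v eu ev|u eu|i u eu].
- by rewrite [Δ 1]rmorph1 -tens1 tlift_pure // /F [ε 1]rmorph1 scale1r.
- by rewrite lD tlift_linear eu ev.
- by rewrite rmorphM LM eu /= En_comulg tlift_pure // /F En_counitg scale1r.
- rewrite rmorphM LM eu; congr (_ * _).
  rewrite /= En_comulx (linD (@tlift_linear _ _ _ _ _)) !tlift_pure // /F.
  by rewrite [ε 1]rmorph1 En_counitx scale1r scale0r add0r.
Qed.

Fact En_antipodel (a : H) : \sw_(b, h <- Δ a) (S b * h) = (ε a)%:A.
Proof.
pose F (b h : H) : H := S b * h.
have bF : bilin F.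
  split=> [h c u v|b c u v]; rewrite /F; last by rewrite mulrDr scalerAr.
  by rewrite lS mulrDl scalerAl.
have FM (s : H) (e : k) t : (forall b h, tlift F (t * (b ⊗ h)) = e *: F b h) ->
    forall u, tlift F (t * u) = e *: tlift F u.
  move=> eF; apply: tens_ind => [c u v eu ev|b h]; last by rewrite eF tlift_pure.
  by rewrite mulrDr -scalerAr !tlift_linear eu ev scalerDr !scalerA mulrC.
rewrite -[LHS]/(tlift F (Δ a)); move: a.
apply: Cl_ind => [|c u v eu ev|u eu|i u eu].
- by rewrite [Δ 1]rmorph1 -tens1 tlift_pure // /F En_antipode1 mulr1 [ε 1]rmorph1 scale1r.
- by rewrite lD tlift_linear eu ev le scalerDl scalerA.
- rewrite rmorphM /= (FM 0 1) ?eu.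
    by rewrite scale1r [ε (_ * _)]rmorphM /= En_counitg mul1r.
  move=> b h; rewrite En_comulg tensM tlift_pure // /F En_antipodeM En_antipodeg.
  by rewrite -!mulrA (mulrA (En_g k n)) En_g2 mul1r scale1r.
- rewrite rmorphM /= (FM 0 0) ?eu.
    by rewrite scale0r [ε (_ * _)]rmorphM /= En_counitx mul0r scale0r.
  move=> b h; rewrite En_comulx mulrDl !tensM (linD (@tlift_linear _ _ _ _ _)).
  rewrite !tlift_pure // /F !En_antipodeM En_antipodex En_antipode1 scale0r.
  have e : En_g k n * En_x k i * (En_g k n * h) = - (En_x k i * h).
    by rewrite En_gx mulNr -mulrA (mulrA (En_g k n)) En_g2 mul1r.
  by rewrite mulr1 -mulrA e mulrN ?mul1r -?mulrA ?addNr.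
Qed.

Fact En_antipoder (a : H) : \sw_(b, h <- Δ a) (b * S h) = (ε a)%:A.
Proof.
pose F (b h : H) : H := b * S h.
have bF : bilin F.
  split=> [h c u v|b c u v]; rewrite /F; first by rewrite mulrDl scalerAl.
  by rewrite lS mulrDr scalerAr.
pose I (t u : tensor H H) := \sw_(b, h <- t) (b * tlift F u * S h).
have bI u : bilin (fun b h : H => b * tlift F u * S h).
  split=> [h c v w|b c v w]; first by rewrite !mulrDl !scalerAl.
  by rewrite lS mulrDr scalerAr.
have FM t u : tlift F (t * u) = I t u.
  move: t; apply: tens_ind => [c t t' e1 e2|b h].
    by rewrite mulrDl -scalerAl /I !tlift_linear e1 e2.
  rewrite /I tlift_pure //.
  move: u; apply: tens_ind => [c t t' e1 e2|b' h'].
    by rewrite mulrDr -scalerAr !tlift_linear e1 e2 mulrDr mulrDl -scalerAr -scalerAl.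
  by rewrite tensM !tlift_pure // /F En_antipodeM !mulrA.
rewrite -[LHS]/(tlift F (Δ a)); move: a.
apply: Cl_ind => [|c u v eu ev|u eu|i u eu].
- by rewrite [Δ 1]rmorph1 -tens1 tlift_pure // /F En_antipode1 mulr1 [ε 1]rmorph1 scale1r.
- by rewrite lD tlift_linear eu ev le scalerDl scalerA.
- rewrite rmorphM FM /I /= En_comulg tlift_pure // eu En_antipodeg -scalerAr mulr1.
  by rewrite -scalerAl En_g2 [ε (_ * _)]rmorphM /= En_counitg mul1r.
- rewrite rmorphM FM /I /= En_comulx (linD (@tlift_linear _ _ _ _ _)) !tlift_pure //.
  rewrite eu En_antipodeg En_antipodex -!scalerAr !mulr1 -!scalerAl mul1r.
  rewrite -scalerDr -[_ * En_g k n]opprK -En_gx addNr scaler0.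
  by rewrite [ε (_ * _)]rmorphM /= En_counitx mul0r scale0r.
Qed.

Definition En_hopf : hopf H :=
  Hopf (@Cl_coactA k n 1 (fun _ => 0) (fun _ => 0) (fun _ _ => 0))
    En_counitl (@Cl_coact_counit k n 1 (fun _ => 0) (fun _ => 0) (fun _ _ => 0))
    En_antipodel En_antipoder (@En_antipode_bij k n).

Definition Cl_comodalg (alpha : k) (beta gamma : 'I_n -> k)
    (lambda : 'I_n -> 'I_n -> k) : comodalg En_hopf (Cl alpha beta gamma lambda) :=
  @ComodAlg k H En_hopf (Cl alpha beta gamma lambda) (Cl_coact alpha beta gamma lambda)
    (@Cl_coactA k n alpha beta gamma lambda)
    (@Cl_coact_counit k n alpha beta gamma lambda).

End EnHopfTheory.

(* Main.v *)
(** Put t(h) = (Id ⊗ ε)(T(h)).  Since Id ⊗ ε is multiplicative, the h-property says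
    that t is an antihomomorphism.  Applying Id ⊗ ε to the second integral condition
    gives t(h) X_i = X_i t(g h g) + t(g h x_i) + t(x_i g h).  At h = g this reads
    2 t(x_i) = t(g) X_i - X_i t(g); so once t(h) t(g) = t(g h) is known for all h, the
    same formula yields t(h) t(x_i) = t(x_i h), and g, x_1, .., x_n generate E(n). *)
Require Import Defs.
From mathcomp Require Import all_boot all_order all_algebra all_field.
Import GRing.Theory.
Local Open Scope ring_scope.

Set Implicit Arguments.
Unset Strict Implicit.

(** * The algebra map Id ⊗ ε *)

Section CounitProjection.
Variables (k : fieldType) (H : falgType k) (hs : hopf H) (A : falgType k).
Local Notation π := (@id_counit k H hs A).

Lemma id_counit_bilin : bilin (fun (a : A) (h : H) => counit hs h *: a).
Proof.
have le : linear (counit hs) by exact: linearP.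
split=> [h c u v|b c u v]; first by rewrite scalerDr !scalerA mulrC.
by rewrite le scalerDl scalerA.
Qed.

Lemma id_counit_tens (a : A) (h : H) : π (a ⊗ h) = counit hs h *: a.
Proof. exact: tlift_pure id_counit_bilin. Qed.

Lemma id_counit_linear : linear π.
Proof. exact: tlift_linear. Qed.

Lemma id_counitM : {morph π : t u / t * u}.
Proof.
apply: (tlift_mul id_counit_bilin) => a a' b b'.
by rewrite rmorphM -scalerAl -scalerAr scalerA.
Qed.

End CounitProjection.

(** * The second integral condition after Id ⊗ ε *)

Section Integral.
Variables (k : fieldType) (H : falgType k) (hs : hopf H).
Variables (A : falgType k) (cs : comodalg hs A).
Variable T : 'Hom(H, tensor A H).
Hypothesis T_int : is_integral cs T.
Local Notation Δ := (comul hs).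
Local Notation ρ := (coact cs).
Local Notation ε := (counit hs).
Local Notation S' := (antipode hs)^-1%VF.
Local Notation π := (@id_counit k H hs A).
Local Notation t h := (π (T h)).

(** The left side of the second condition, split into one function per Sweedler sum: each is
    bilinear, so [tlift_pure] can peel off the sums one at a time. *)
Let E h (a0 : A) (a1 a2 a3 : H) : tensor A H :=
  (a0 ⊗ 1) * T (S' a2 * h * a1) * (1 ⊗ S' a3).
Let E3 h a0 a1 c := \sw_(a2, a3 <- Δ c) E h a0 a1 a2 a3.
Let E2 h a0 b := \sw_(a1, c <- Δ b) E3 h a0 a1 c.
Let R h (a0 : A) (a1 : H) : tensor A H := (1 ⊗ S' a1) * T h * (a0 ⊗ 1).

Let lT : linear T. Proof. exact: linearP. Qed.
Let lS : linear S'. Proof. exact: linearP. Qed.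
Let lD : linear Δ. Proof. exact: linearP. Qed.

Let E_bilin h a0 a1 : bilin (E h a0 a1).
Proof.
split=> [a3 c u v|a2 c u v]; rewrite /E.
  by rewrite lS !mulrDl -!scalerAl lT mulrDr -scalerAr mulrDl -scalerAl.
by rewrite lS tensDr mulrDr -scalerAr.
Qed.

Let E3_bilin h a0 : bilin (E3 h a0).
Proof.
split=> [c d u v|a1 d u v]; rewrite /E3; last by rewrite lD tlift_linear.
rewrite -tlift_fun; apply: eq_tlift => a2 a3; rewrite /E.
by rewrite mulrDr -scalerAr lT mulrDr -scalerAr mulrDl -scalerAl.
Qed.

Let E2_bilin h : bilin (E2 h).
Proof.
split=> [b d u v|a0 d u v]; rewrite /E2; last by rewrite lD tlift_linear.
rewrite -tlift_fun; apply: eq_tlift => a1 c; rewrite /E3.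
rewrite -tlift_fun; apply: eq_tlift => a2 a3; rewrite /E.
by rewrite tensDl !mulrDl -!scalerAl.
Qed.

Let R_bilin h : bilin (R h).
Proof.
split=> [b d u v|a0 d u v]; rewrite /R.
  by rewrite tensDl mulrDr -scalerAr.
by rewrite lS tensDr !mulrDl -!scalerAl.
Qed.

Let T_intE a h : tlift (E2 h) (ρ a) = tlift (R h) (ρ a).
Proof. exact: T_int.2. Qed.

Let πE h a0 a1 a2 a3 :
  π (E h a0 a1 a2 a3) = ε (S' a3) *: (a0 * t (S' a2 * h * a1)).
Proof.
rewrite /E !id_counitM !id_counit_tens rmorph1 scale1r.
by rewrite -scalerAr mulr1.
Qed.

Let πR h a0 a1 : π (R h a0 a1) = ε (S' a1) *: (t h * a0).
Proof.
rewrite /R !id_counitM !id_counit_tens rmorph1 scale1r.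
by rewrite -!scalerAl mul1r.
Qed.

Variables (g : H).
Hypotheses (Δg : Δ g = g ⊗ g) (S'g : S' g = g) (εg : ε g = 1).

(** The iterated coaction of [X] has four terms, X⊗g⊗g⊗g, 1⊗x⊗g⊗g, 1⊗1⊗x⊗g and 1⊗1⊗1⊗x. The first
    three give the summands on the right; the last is killed by [ε (S' x) = 0], as is the term 1⊗x
    on the other side. *)
Lemma integral_skew_primitive X x h : ρ X = X ⊗ g + 1 ⊗ x ->
    Δ x = x ⊗ g + 1 ⊗ x -> S' 1 = 1 -> ε (S' x) = 0 ->
  t h * X = X * t (g * h * g) + t (g * h * x) + t (S' x * h).
Proof.
move=> ρX Δx S'1 εx; have := congr1 π (T_intE X h).
have tD (V W : vectType k) (U : lmodType k) (f : V -> W -> U) :=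
  linD (tlift_linear f).
have πD := linD (@id_counit_linear k H hs A).
rewrite ρX !tD !tlift_pure // /E2 Δg Δx tD !tlift_pure //.
rewrite /E3 Δg Δx tD !tlift_pure // !πD !πE !πR.
by rewrite S'g S'1 εx εg !scale1r !scale0r !addr0 !mul1r !mulr1 addrA => <-.
Qed.

End Integral.

(** * Spanning E(n) by the monomials x_P and g x_P *)

Section EnBasis.
Variables (k : fieldType) (n : nat).
Local Notation g := (En_g k n).
Local Notation x := (@En_x k n).
Local Notation ltI := (fun i j : 'I_n => (i < j)%N).

Let ltI_trans : transitive ltI. Proof. by move=> j i l; apply: ltn_trans. Qed.

Let elems (P : {set 'I_n}) := [seq i <- index_enum 'I_n | i \in P].

Let En_xPE P : En_xP k P = \prod_(i <- elems P) x i.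
Proof. by rewrite big_filter. Qed.

Let elems_sorted (P : {set 'I_n}) : sorted ltI (elems P).
Proof.
apply: sorted_filter => //.
have := iota_ltn_sorted 0 n; rewrite -val_enum_ord sorted_map.
by rewrite [index_enum _]unlock -enumT.
Qed.

Lemma En_prod_sorted (s : seq 'I_n) : sorted ltI s ->
  \prod_(i <- s) x i = En_xP k [set i in s].
Proof.
move=> sorted_s; rewrite En_xPE; congr bigop.
apply: (irr_sorted_eq ltI_trans) => // [i|i]; first exact: ltnn.
by rewrite mem_filter mem_index_enum inE andbT.
Qed.

(** Insertion sort: each transposition contributes a sign, and a repeated index gives 0. The
    inclusion of [r] in [i :: s] is carried along so that a smaller head can be put back in front of
    [r]. *)
Lemma En_x_mul_sorted i (s : seq 'I_n) : sorted ltI s ->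
  exists c : k, exists r, [/\ sorted ltI r, {subset r <= i :: s}
    & x i * \prod_(j <- s) x j = c *: \prod_(j <- r) x j].
Proof.
elim: s => [|j s IH] /= sorted_s.
  by exists 1, [:: i]; split; rewrite // scale1r big_seq1 big_nil mulr1.
case: (ltngtP i j) => [lt_ij|lt_ji|/val_inj ->].
- by exists 1, [:: i, j & s]; split; rewrite /= ?lt_ij // scale1r !big_cons.
- have [c [r [sorted_r sub_r eq_r]]] := IH (path_sorted sorted_s).
  exists (- c), (j :: r); split.
  + rewrite /= path_min_sorted //; apply/allP=> l /sub_r.
    rewrite inE => /orP[/eqP->//|]; move: l.
    exact/allP/(order_path_min ltI_trans).
  + move=> l; rewrite !inE => /orP[->|/sub_r]; first by rewrite orbT.
    by rewrite inE => /orP[] ->; rewrite ?orbT.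
  + rewrite !big_cons mulrA -[x i * x j]opprK -(En_xx k lt_ji) mulNr -mulrA eq_r.
    by rewrite -scalerAr scaleNr.
- by exists 0, [::]; rewrite scale0r big_cons mulrA En_x2 mul0r.
Qed.

Lemma En_x_mul_xP i P : exists c : k, exists Q, x i * En_xP k P = c *: En_xP k Q.
Proof.
have [c [r [sorted_r _ eq_r]]] := En_x_mul_sorted i (elems_sorted P).
by exists c, [set j in r]; rewrite -(En_prod_sorted sorted_r) En_xPE.
Qed.

(** The span of these monomials contains 1 and is stable under left multiplication by g and by every
    x_i, hence is all of E(n). *)
Lemma En_basis_ind (K : En k n -> Prop) :
    (forall c u v, K u -> K v -> K (c *: u + v)) ->
    (forall P, K (En_xP k P)) -> (forall P, K (g * En_xP k P)) ->
  forall h, K h.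
Proof.
(* For all K at once, since the steps for g and x_i use the hypothesis at K (g * _)
   and K (x_i * _). *)
move=> Kl Kx Kgx h; move: h K Kl Kx Kgx.
apply: Cl_ind => [|c u v Ku Kv|u Ku|i u Ku] K Kl Kx Kgx.
- by have := Kx set0; rewrite /En_xP big_set0.
- exact: Kl (Ku K Kl Kx Kgx) (Kv K Kl Kx Kgx).
- refine (Ku (fun u => K (g * u)) _ _ _) => [c v w Kv Kw||P] //.
  + by rewrite mulrDr -scalerAr; apply: Kl.
  + by rewrite mulrA En_g2 mul1r.
- have K0 : K 0 by have := Kl (-1) _ _ (Kx set0) (Kx set0); rewrite scaleN1r addNr.
  have KZ c v : K v -> K (c *: v) by move=> Kv; rewrite -[_ *: v]addr0; apply: Kl.
  refine (Ku (fun u => K (x i * u)) _ _ _) => [c v w Kv Kw|P|P].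
  + by rewrite mulrDr -scalerAr; apply: Kl.
  + by have [c [Q ->]] := En_x_mul_xP i P; apply: KZ.
  + rewrite mulrA -[x i * g]opprK -En_gx mulNr -mulrA -scaleN1r; apply: (KZ).
    by have [c [Q ->]] := En_x_mul_xP i P; rewrite -scalerAr; apply: KZ.
Qed.

End EnBasis.

(** * From multiplication by t(g) to the antihomomorphism property *)

Section EnIntegral.
Variables (k : fieldType) (n : nat).
Variables (alpha : k) (beta gamma : 'I_n -> k) (lambda : 'I_n -> 'I_n -> k).
Local Notation A := (Cl alpha beta gamma lambda).
Local Notation X := (Cl_X alpha beta gamma lambda).
Local Notation H := (En k n).
Local Notation g := (En_g k n).
Local Notation x := (@En_x k n).
Local Notation S := (En_antipode k n).
Local Notation S' := (En_antipode k n)^-1%VF.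
Variable T : 'Hom(H, tensor A H).
Hypothesis T_int : is_integral (Cl_comodalg alpha beta gamma lambda) T.
Local Notation t h := (id_counit (En_hopf k n) (T h)).

Let S'K : cancel S S'.
Proof.
by apply: lker0_lfunK; apply/lker0P; apply: bij_inj (En_antipode_bij k n).
Qed.

Let S'1 : S' 1 = 1.
Proof. by rewrite -{1}(En_antipode1 k n) S'K. Qed.

Let S'g : S' g = g.
Proof. by rewrite -{1}(En_antipodeg k n) S'K. Qed.

Let S'x i : S' (x i) = x i * g.
Proof.
have {1}-> : x i = S (x i * g); last by rewrite S'K.
by rewrite En_antipodeM En_antipodeg En_antipodex mulrA En_g2 mul1r.
Qed.

Lemma En_integral_X i h :
  t h * X i = X i * t (g * h * g) + t (g * h * x i) + t (x i * g * h).
Proof.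
rewrite -S'x; apply: (integral_skew_primitive T_int) => //=.
- exact: En_comulg.
- exact: En_counitg.
- exact: Cl_coactX.
- exact: En_comulx.
- by rewrite S'x [En_counit k n _]rmorphM /= En_counitx mul0r.
Qed.

(** Once known for [h'] equal to g or some x_i, the identity passes from u to g u and x_i u, so
    induction on [h'] finishes. *)
Lemma En_integral_antihom : 2%N \notin [pchar k] -> T 1 = 1 ⊗ 1 ->
    (forall h, t h * t g = t (g * h)) -> forall h h', t h * t h' = t (h' * h).
Proof.
move=> char_k T1 tg.
have lt : linear (fun h => t h).
  by move=> c u v; rewrite linearP id_counit_linear.
have tN u : t (- u) = - t u by rewrite -scaleN1r (linZ lt) scaleN1r.
have gg u : g * (g * u) = u by rewrite mulrA En_g2 mul1r.
have tx i h : t h * t (x i) = t (x i * h).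
  have two_tx : t (x i) *+ 2 = t g * X i - X i * t g.
    rewrite En_integral_X -!mulrA !gg En_g2 mulr1.
    by rewrite [RHS]addrC !addrA addNr add0r mulr2n.
  have two_neq0 : (2%:R : k) != 0 by move: char_k; rewrite inE.
  suff e : (t h * t (x i)) *+ 2 = t (x i * h) *+ 2.
    by apply: (scalerI two_neq0); rewrite !scaler_nat.
  (* Here t(gh) X_i = X_i t(hg) + t(h x_i) + t(x_i h), while t(h) X_i t(g) has the same first two
     terms and then t(g x_i g h) = - t(x_i h). The difference is 2 t(x_i h). *)
  rewrite -mulrnAr two_tx mulrBr !mulrA tg !En_integral_X.
  rewrite !mulrDl -!mulrA !tg !gg.
  have -> : g * (x i * (g * h)) = - (x i * h) by rewrite mulrA En_gx mulNr -mulrA gg.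
  by rewrite tN opprB [LHS]addrC addrA addrNK -mulr2n.
move=> h h'; move: h' h.
apply: Cl_ind => [|c u v eu ev|u eu|i u eu] h.
- by rewrite T1 id_counit_tens rmorph1 scale1r mulr1 mul1r.
- by rewrite lt mulrDr -scalerAr eu ev mulrDl -scalerAl lt.
- by rewrite -[Cl_G _ _ _ _]/g -tg mulrA eu tg mulrA.
- by rewrite -[Cl_X _ _ _ _ i]/(x i) -tx mulrA eu tx mulrA.
Qed.

End EnIntegral.

Theorem proposition4p14 (k : fieldType) (char_k : 2%N \notin [pchar k])
    (n : nat) (n_gt0 : (0 < n)%N)
    (alpha : k) (beta gamma : 'I_n -> k) (lambda : 'I_n -> 'I_n -> k)
    (T : 'Hom(En k n, tensor (Cl alpha beta gamma lambda) (En k n)))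
    (T_total : is_total_integral (Cl_comodalg alpha beta gamma lambda) T) :
  h_property (En_hopf k n) T <->
  (id_counit (En_hopf k n) (T (En_g k n) * T (En_g k n)) = 1
   /\ forall P : {set 'I_n},
        id_counit (En_hopf k n) (T (En_xP k P) * T (En_g k n)) =
        id_counit (En_hopf k n) (T (En_g k n * En_xP k P))).
Proof.
have [T_int T1] := T_total.
split=> [hT|[tgg tPg]].
  split=> [|P]; last exact: hT.
  by rewrite hT En_g2 T1 id_counit_tens rmorph1 scale1r.
move=> h h'; rewrite id_counitM.
apply: (En_integral_antihom T_int) => // {h h'}.
apply: En_basis_ind => [c u v eu ev|P|P].
- rewrite mulrDr -scalerAr !linearP !id_counit_linear.
  by rewrite mulrDl -scalerAl eu ev.
- by rewrite -id_counitM tPg.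
(* t(g x_P) t(g) = t(x_P) t(g) t(g) = t(x_P) = t(g g x_P). *)
- by rewrite -tPg id_counitM -mulrA -id_counitM tgg mulr1 mulrA En_g2 mul1r.
Qed.
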